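(* Let $\ell:\mathcal D\times\mathcal Y^{\mathcal D}\times\mathcal X\to\mathbb R$ be a bounded counterfactual loss. Then the following are equivalent: (i) for every pair of policies $\pi,\rho:\mathcal X\to\Delta(\mathcal D)$, the risk difference $P\mapsto R_P(\pi;\ell)-R_P(\rho;\ell)$ is identifiable on $\mathcal P$; (ii) $\ell$ is additive, i.e. there exist bounded measurable functions $\omega_k:\mathcal D\times\mathcal Y\times\mathcal X\to\mathbb R$ ($k\in\mathcal D$) and $\varpi:\mathcal Y^{\mathcal D}\times\mathcal X\to\mathbb R$ such that $$\ell(d;\boldsymbol y,\boldsymbol x)=\varpi(\boldsymbol y,\boldsymbol x)+\sum_{k\in\mathcal D}\omega_k(d,y_k,\boldsymbol x)$$ for all $d\in\mathcal D$, $\boldsymbol y=(y_0,\dots,y_{K-1})\in\mathcal Y^{\mathcal D}$, $\boldsymbol x\in\mathcal X$.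
   Context: Setup. Let $\mathcal X$ be an arbitrary measurable space, $K,M\ge 2$ integers, $\mathcal D=\{0,\dots,K-1\}$ (decisions), $\mathcal Y=\{0,\dots,M-1\}$ (outcomes). $\Delta(S)$ denotes the set of probability measures on $S$. Potential outcomes are $Y(k)\in\mathcal Y$, $k\in\mathcal D$, with $Y(\mathcal D)=(Y(0),\dots,Y(K-1))\in\mathcal Y^{\mathcal D}$; covariates are $\boldsymbol X\in\mathcal X$; $D\in\mathcal D$ is the observed decision. Given a law $P_{Y(\mathcal D),\boldsymbol X}\in\Delta(\mathcal Y^{\mathcal D}\times\mathcal X)$ and a treatment assignment mechanism (a measurable map $e:\mathcal Y^{\mathcal D}\times\mathcal X\to\Delta(\mathcal D)$, written $e(k;\boldsymbol y,\boldsymbol x)$), the joint law $P=e\cdot P_{Y(\mathcal D),\boldsymbol X}$ of $(D,Y(\mathcal D),\boldsymbol X)$ is $$P(D=k,Y(\mathcal D)=\boldsymbol y,\boldsymbol X\in A)=\int_A e(k;\boldsymbol y,\boldsymbol x)\,P_{Y(\mathcal D)\mid\boldsymbol X}(Y(\mathcal D)=\boldsymbol y\mid\boldsymbol X=\boldsymbol x)\,dP_{\boldsymbol X}(\boldsymbol x)$$ for $A\subseteq\mathcal X$ measurable. Consistency: the observed outcome is $Y=Y(D)$. Strong ignorability of $e$ with respect to $P_{Y(\mathcal D),\boldsymbol X}$: (a) unconfoundedness, $e(d;\boldsymbol y,\boldsymbol x)=e(d;\boldsymbol x)$ for every $d\in\mathcal D$, $P_{Y(\mathcal D),\boldsymbol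 X}$-a.s.; (b) overlap, $e(d;\boldsymbol x)>0$ for every $d\in\mathcal D$, $P_{\boldsymbol X}$-a.s. $\mathcal P$ is the set of all joint laws $P=e\cdot P_{Y(\mathcal D),\boldsymbol X}$ with $P_{Y(\mathcal D),\boldsymbol X}\in\Delta(\mathcal Y^{\mathcal D}\times\mathcal X)$ arbitrary and $e$ strongly ignorable with respect to it. The observed law $Q_P$ of $(D,Y,\boldsymbol X)$ is $Q_P(D=k,Y=y,\boldsymbol X\in A)=P(D=k,Y(k)=y,\boldsymbol X\in A)$. A policy is a (measurable) map $\pi:\mathcal X\to\Delta(\mathcal D)$, written $\pi(d;\boldsymbol x)$. A counterfactual loss is a measurable function $\ell:\mathcal D\times\mathcal Y^{\mathcal D}\times\mathcal X\to\mathbb R$, written $\ell(d;\boldsymbol y,\boldsymbol x)$; it is bounded if $\sup|\ell|<\infty$. The conditional counterfactual risk is $$R_{P_{Y(\mathcal D)\mid\boldsymbol X=\boldsymbol x}}(\pi;\ell)=\sum_{d\in\mathcal D}\sum_{\boldsymbol y\in\mathcal Y^{\mathcal D}}\ell(d;\boldsymbol y,\boldsymbol x)\,\pi(d;\boldsymbol x)\,P(Y(\mathcal D)=\boldsymbol y\mid\boldsymbol X=\boldsymbol x)$$ (defined $P_{\boldsymbol X}$-a.s.) and the counterfactual risk is $R_P(\pi;\ell)=\mathbb E_{P_{\boldsymbol X}}[R_{P_{Y(\mathcal D)\mid\boldsymbol X}}(\pi;\ell)]$. Identifiability. A functional $\theta:\mathcal P\to\mathbb R$ is identifiable if for all $P_1,P_2\in\mathcal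 P$ with $Q_{P_1}=Q_{P_2}$ one has $\theta(P_1)=\theta(P_2)$. *)

(* Defs.v *)
From HB Require Import structures.
From mathcomp Require Export all_boot all_order all_algebra.
From mathcomp Require Export all_classical all_reals all_analysis.

Set Implicit Arguments.
Unset Strict Implicit.
Unset Printing Implicit Defensive.

Import Order.TTheory GRing.Theory Num.Theory.
Import numFieldNormedType.Exports.

Local Open Scope classical_set_scope.
Local Open Scope ring_scope.
Local Open Scope charge_scope.

HB.instance Definition _ n := isPointed.Build 'I_n.+1 ord0.
HB.instance Definition _ n := @isMeasurable.Build default_measure_display
  'I_n.+1 discrete_measurable discrete_measurable0
  discrete_measurableC discrete_measurableU.

HB.instance Definition _ n m :=
  isPointed.Build {ffun 'I_n -> 'I_m.+1} [ffun=> ord0].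
HB.instance Definition _ n m := @isMeasurable.Build default_measure_display
  {ffun 'I_n -> 'I_m.+1} discrete_measurable discrete_measurable0
  discrete_measurableC discrete_measurableU.

(** The spaces of decisions, outcomes and potential outcome vectors. Ordinals
    with at least two elements: the number K of decisions is [k.+2] and the
    number M of outcomes is [m.+2]. All three carry the discrete
    sigma-algebra. *)
Notation decision k := 'I_k.+2 (only parsing).
Notation outcome m := 'I_m.+2 (only parsing).
Notation potential k m := {ffun 'I_k.+2 -> 'I_m.+2} (only parsing).

Section projections.
Context (k m : nat) (d : measure_display) (X : measurableType d).

Definition covariate (z : potential k m * X) : X := z.2.

Definition unassigned (z : decision k * potential k m * X) :
  potential k m * X := (z.1.2, z.2).

(** Consistency: the observed outcome is the potential outcome of the observed
    decision. *)
Definition observed (z : decision k * potential k m * X) :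
  decision k * outcome m * X := (z.1.1, z.1.2 z.1.1, z.2).

Lemma measurable_covariate : measurable_fun [set: _] covariate.
Proof. exact: measurable_snd. Qed.

HB.instance Definition _ :=
  isMeasurableFun.Build _ _ _ _ covariate measurable_covariate.

Lemma measurable_unassigned : measurable_fun [set: _] unassigned.
Proof.
apply/measurable_fun_pair => /=; last exact: measurable_snd.
exact: (measurableT_comp measurable_snd measurable_fst).
Qed.

HB.instance Definition _ :=
  isMeasurableFun.Build _ _ _ _ unassigned measurable_unassigned.

Lemma measurable_observed : measurable_fun [set: _] observed.
Proof.
apply/measurable_fun_pair => /=; last exact: measurable_snd.
pose f (u : decision k * potential k m) := (u.1, u.2 u.1).
have mf : measurable_fun [set: decision k * potential k m] f.
  move=> _ B _; rewrite setTI.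
  rewrite (_ : f @^-1` B = \bigcup_(u in f @^-1` B) ([set u.1] `*` [set u.2])).
    apply: fin_bigcup_measurable; first exact: finite_finset.
    by move=> u _; apply: measurableX.
  apply/seteqP; split => [u Bu|u [v Bv [/= u1 u2]]]; first by exists u.
  by rewrite (surjective_pairing u) u1 u2 -surjective_pairing.
exact: (measurableT_comp mf measurable_fst).
Qed.

HB.instance Definition _ :=
  isMeasurableFun.Build _ _ _ _ observed measurable_observed.

End projections.

Arguments covariate {k m d X}.
Arguments unassigned {k m d X}.
Arguments observed {k m d X}.

Section counterfactual_risk.
Context (R : realType) (k m : nat) (d : measure_display) (X : measurableType d).

Section potential_law.
Variable P : probability (potential k m * X)%type R.

Definition covariate_law : probability X R := distribution P covariate.

Section slice.
Variable y : potential k m.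

Definition slice (A : set X) : \bar R := P ([set y] `*` A).

Let slice0 : slice set0 = 0%E.
Proof. by rewrite /slice setX0 measure0. Qed.

Let slice_ge0 A : (0 <= slice A)%E.
Proof. exact: measure_ge0. Qed.

Let slice_sigma_additive : semi_sigma_additive slice.
Proof.
move=> F mF tF mUF; rewrite /slice setX_bigcupr.
apply: measure_semi_sigma_additive.
- by move=> i; apply: measurableX.
- apply/trivIsetP => i j _ _ ij; rewrite -setXI.
  by move/trivIsetP : tF => /(_ _ _ _ _ ij) ->//; rewrite setX0.
- by rewrite -setX_bigcupr; apply: measurableX.
Qed.

HB.instance Definition _ := isMeasure.Build _ _ _ slice
  slice0 slice_ge0 slice_sigma_additive.

Let slice_fin : fin_num_fun slice.
Proof. by move=> A mA; apply: fin_num_measure; apply: measurableX. Qed.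

HB.instance Definition _ := Measure_isFinite.Build _ _ _ slice slice_fin.

End slice.

(** A version of [P(Y(D) = y | X = x)]: the Radon-Nikodym derivative of
    [A |-> P(Y(D) = y, X \in A)] with respect to the law of [X]. *)
Definition cond_prob (y : potential k m) : X -> \bar R :=
  'd (charge_of_finite_measure (slice y)) '/d covariate_law.

Lemma cond_probP (y : potential k m) (A : set X) : measurable A ->
  P ([set y] `*` A) = (\int[covariate_law]_(x in A) cond_prob y x)%E.
Proof.
move=> mA; rewrite /cond_prob -Radon_Nikodym_integral//.
apply/null_content_dominatesP => B mB /= PB0.
apply: (@subset_measure0 _ _ _ P _ (covariate @^-1` B)) => //.
- exact: measurableX.
- by rewrite -[X in measurable X]setTI; exact: measurable_covariate.
- by move=> [y' x] [].
Qed.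

End potential_law.

Section risk.
Variable P : probability (decision k * potential k m * X)%type R.

Definition potential_law : probability (potential k m * X)%type R :=
  distribution P unassigned.

Definition observed_law : probability (decision k * outcome m * X)%type R :=
  distribution P observed.

Variables (pi : R.-pker X ~> decision k)
  (l : decision k * potential k m * X -> R).

Definition cond_risk (x : X) : R :=
  \sum_(a : decision k) \sum_(y : potential k m)
    l (a, y, x) * fine (pi x [set a]) * fine (cond_prob potential_law y x).

Definition risk : R :=
  (\int[covariate_law potential_law]_x cond_risk x)%R.

End risk.

Definition strongly_ignorable
    (e : R.-pker (potential k m * X)%type ~> decision k)
    (P : probability (potential k m * X)%type R) :=
  exists e0 : R.-pker X ~> decision k,
    (forall a, {ae P, forall z, e z [set a] = e0 z.2 [set a]}) /\
    (forall a, {ae covariate_law P, forall x, (0 < e0 x [set a])%E}).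

(** [P] is the joint law obtained from the law [P0] of the potential outcomes
    and covariates and the assignment mechanism [e]. *)
Definition is_joint_law
    (e : R.-pker (potential k m * X)%type ~> decision k)
    (P0 : probability (potential k m * X)%type R)
    (P : probability (decision k * potential k m * X)%type R) :=
  forall a y A, measurable A ->
    P ([set a] `*` [set y] `*` A) =
    (\int[covariate_law P0]_(x in A)
       (e (y, x) [set a] * cond_prob P0 y x))%E.

Definition model : set (probability (decision k * potential k m * X)%type R) :=
  [set P | exists e P0, strongly_ignorable e P0 /\ is_joint_law e P0 P].

(** Two laws are the same when they agree on measurable sets; on the other
    sets the value of a measure carries no information. *)
Definition identifiable
    (theta : probability (decision k * potential k m * X)%type R -> R) :=
  forall P1 P2, model P1 -> model P2 ->
    (forall A, measurable A -> observed_law P1 A = observed_law P2 A) ->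
    theta P1 = theta P2.

Definition additive_loss (l : decision k * potential k m * X -> R) :=
  exists (omega : decision k -> {mfun (decision k * outcome m * X)%type >-> R})
         (varpi : {mfun (potential k m * X)%type >-> R}),
    [/\ forall j, bounded_fun (omega j),
        bounded_fun varpi &
        forall a y x, l (a, y, x) =
          varpi (y, x) + \sum_(j : decision k) omega j (a, y j, x)].

End counterfactual_risk.

(* Main.v *)
From HB Require Import structures.
Require Import Defs.
From mathcomp Require Import perm measurable_realfun.

Set Implicit Arguments.
Unset Strict Implicit.
Unset Printing Implicit Defensive.

Import Order.TTheory GRing.Theory Num.Theory.
Import numFieldNormedType.Exports.

Local Open Scope classical_set_scope.
Local Open Scope ring_scope.

(** Additive losses have identifiable risk differences because a difference of
    two policies has total mass zero, so the term [varpi] cancels, and each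
    remaining term [omega j] sees the potential outcomes through their [j]-th
    coordinate only. The risk difference is thus a function of the law of the
    covariates and of the conditional laws of the single outcomes [Y(j)] given
    the covariates ([additive_cond_risk_difference]). Both can be read off the
    observed law Q. Under unconfoundedness, with propensity score [e0],
      Q(D = j, Y = v, X in A)
        = \int_A e0(j; x) P(Y(j) = v | X = x) dP_X(x),
    and summing over [v] gives Q(D = j, X in A) = \int_A e0(j; x) dP_X(x).
    Hence [e0] is determined almost everywhere, then so is the product of [e0]
    with the conditional law of [Y(j)], and overlap permits division by [e0]
    ([marginal_identified]).

    Conversely, identifiability is tested on very small models: a covariate
    concentrated at one point [x], a decision drawn uniformly and independently
    of everything else, and a potential outcome vector drawn uniformly from a
    finite list of K vectors ([mixture]). Given a vector [y], compare the list
    made of [y] and K - 1 copies of the zero vector with the list of the K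
    vectors obtained from the zero vector by moving its [j]-th coordinate to
    [y j]. In every fixed coordinate the two lists contain the same outcomes
    with the same multiplicities, so the observed laws coincide. Comparing the
    policy that always decides [a] with the one that always decides 0, and
    writing g(y) = l(a, y, x) - l(0, y, x), identifiability becomes
      g(y) + (K - 1) g(0) = \sum_j g(0 with j-th coordinate y j)
    ([identifiable_contrast]). This is an additive decomposition of the
    difference with [l(0, y, x)]; it is explicit in [l], so measurability and
    boundedness of its terms are inherited from [l]. *)

(** * Measures and kernels on finite spaces *)

Section finite_factor.
Context d1 d2 d3 (A : measurableType d1) (X : measurableType d2)
  (T : measurableType d3).
Hypotheses (finA : finite_set [set: A]) (mA : forall a : A, measurable [set a]).

Lemma measurable_fun_finite_factor (f : A * X -> T) :
  (forall a, measurable_fun [set: X] (fun x => f (a, x))) ->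
  measurable_fun [set: A * X] f.
Proof.
move=> mf _ B mB; rewrite setTI.
rewrite (_ : f @^-1` B =
  \bigcup_(a in [set: A]) ([set a] `*` ((fun x => f (a, x)) @^-1` B))).
  apply: fin_bigcup_measurable => // a _; apply: measurableX => //.
  by rewrite -[X in measurable X]setTI; exact: mf.
apply/seteqP; split => [[a x] Bx|[a x] [b _ [/= -> //]]].
by exists a.
Qed.

End finite_factor.

Lemma measure_fin_partition d (T : measurableType d) (R : realType)
    (mu : {measure set T -> \bar R}) (I : finType) (P : pred I)
    (F : I -> set T) :
  (forall i, measurable (F i)) -> trivIset [set: I] F ->
  mu (\bigcup_(i in [set` P]) F i) = (\sum_(i | P i) mu (F i))%E.
Proof.
move=> mF tF; rewrite measure_fin_bigcup//.
- rewrite -(@bigfs _ _ _ _ (index_enum I))//; first exact: index_enum_uniq.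
  by move=> i _; rewrite mem_index_enum.
- exact: sub_trivIset tF.
Qed.

Section kernel_prob.
Context d (Y : measurableType d) (R : realType) (n : nat).
Variable e : R.-pker Y ~> 'I_n.+1.

Definition kprob (a : 'I_n.+1) (x : Y) : R := fine (e x [set a]).

Lemma kernel_le1 a x : (e x [set a] <= 1)%E.
Proof.
by rewrite -(prob_kernel (s := e) x); apply: le_measure => //; rewrite inE.
Qed.

Lemma kprobE a x : e x [set a] = (kprob a x)%:E.
Proof.
rewrite /kprob fineK// ge0_fin_numE//.
by rewrite (le_lt_trans (kernel_le1 a x))// ltry.
Qed.

Lemma kprob_ge0 a x : 0 <= kprob a x.
Proof. by rewrite /kprob fine_ge0. Qed.

Lemma kprob_le1 a x : kprob a x <= 1.
Proof. by rewrite -lee_fin -kprobE kernel_le1. Qed.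

Lemma kprob_bounded a (T : Type) (g : T -> Y) (D : set T) :
  [bounded kprob a (g x) | x in D].
Proof.
exists 1; split => // M M1 x _; rewrite /= ger0_norm ?kprob_ge0//.
by rewrite (le_trans (kprob_le1 _ _))// ltW.
Qed.

Lemma kernel_sum1 x : (\sum_a e x [set a] = 1)%E.
Proof.
rewrite -(prob_kernel (s := e) x) -(measure_fin_partition (e x) xpredT)//.
  by congr (e x _); apply/seteqP; split => a // _; exists a.
by apply/trivIsetP => a b _ _ ab; apply/seteqP; split => // c [/= -> /eqP];
  rewrite (negbTE ab).
Qed.

Lemma kprob_sum1 x : \sum_a kprob a x = 1.
Proof.
apply/EFin_inj; rewrite -sumEFin -(kernel_sum1 x).
by apply: eq_bigr => a _; rewrite kprobE.
Qed.

Lemma measurable_kernel_set1 a : measurable_fun [set: Y] (fun x => e x [set a]).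
Proof. exact: measurable_kernel. Qed.

Lemma measurable_kprob a : measurable_fun [set: Y] (kprob a).
Proof.
apply/measurable_EFinP; rewrite (_ : EFin \o _ = fun x => e x [set a]).
  exact: measurable_kernel_set1.
by apply/funext => x; rewrite /= kprobE.
Qed.

End kernel_prob.

(** * Conditional probabilities of the potential outcomes *)

Section cond_prob.
Context (R : realType) (k m : nat) (d : measure_display) (X : measurableType d).
Variable P : probability (potential k m * X)%type R.
Implicit Types (y : potential k m) (A : set X).

Lemma slice_dominates y : slice P y `<< covariate_law P.
Proof.
apply/null_content_dominatesP => B mB PB0.
apply: (@subset_measure0 _ _ _ P _ (covariate @^-1` B)) => //.
- exact: measurableX.
- by rewrite -[X in measurable X]setTI; exact: measurable_covariate.
- by move=> [y' x] [].
Qed.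

Lemma cond_prob_fin_num y x : cond_prob P y x \is a fin_num.
Proof. exact/Radon_Nikodym_fin_num/slice_dominates. Qed.

Lemma integrable_cond_prob y :
  (covariate_law P).-integrable [set: X] (cond_prob P y).
Proof. exact/Radon_Nikodym_integrable/slice_dominates. Qed.

Lemma measurable_cond_prob y : measurable_fun [set: X] (cond_prob P y).
Proof. exact/(measurable_int (covariate_law P))/integrable_cond_prob. Qed.

Definition density y x : R := fine (cond_prob P y x).

Lemma cond_probE y x : cond_prob P y x = (density y x)%:E.
Proof. by rewrite /density fineK// cond_prob_fin_num. Qed.

Lemma measurable_density y : measurable_fun [set: X] (density y).
Proof.
apply/measurable_EFinP; rewrite (_ : EFin \o _ = cond_prob P y).
  exact: measurable_cond_prob.
by apply/funext => x; rewrite /= cond_probE.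
Qed.

Lemma integral_slice y (f : X -> R) A : measurable A ->
  measurable_fun [set: X] f -> [bounded f x | x in [set: X]] ->
  (\int[slice P y]_(x in A) (f x)%:E =
   \int[covariate_law P]_(x in A) (f x * density y x)%:E)%E.
Proof.
move=> mA mf bf.
rewrite -(Radon_Nikodym_change_of_variables (slice_dominates y))//.
  by apply: eq_integral => x _; rewrite EFinM -cond_probE.
apply: (integrableS measurableT) => //.
apply: measurable_bounded_integrable => //.
by rewrite ltey_eq fin_num_measure.
Qed.

Lemma integrable_density y :
  (covariate_law P).-integrable [set: X] (EFin \o density y).
Proof.
rewrite (_ : _ \o _ = cond_prob P y); first exact: integrable_cond_prob.
by apply/funext => x; rewrite /= cond_probE.
Qed.

Lemma trivIset_slices A :
  trivIset [set: potential k m] (fun y => [set y] `*` A).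
Proof.
apply/trivIsetP => y y' _ _ yy'; apply/seteqP; split => // -[z x].
move=> [[/= -> _] [/eqP]].
by rewrite (negbTE yy').
Qed.

Lemma covariate_law_sum A : measurable A ->
  covariate_law P A = (\sum_y P ([set y] `*` A))%E.
Proof.
move=> mA; rewrite -(measure_fin_partition P xpredT).
- congr (P _); apply/seteqP.
  by split => [[y x] Ax|[y x] [y' _ []]//]; exists y.
- by move=> y; apply: measurableX.
- exact: trivIset_slices.
Qed.

(** Only almost everywhere: each density is an arbitrary version of a
    Radon-Nikodym derivative. *)
Lemma ae_density_sum1 :
  {ae covariate_law P, forall x, \sum_y density y x = 1}.
Proof.
have : ae_eq (covariate_law P) [set: X]
    (fun x => \sum_y (density y x)%:E)%E (cst 1%E).
  apply: integral_ae_eq => //.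
  - by apply: integrable_sum => // y _; exact: integrable_density.
  - move=> A _ mA; rewrite integral_cst// mul1e [RHS]covariate_law_sum//.
    rewrite integral_sum//.
      apply: eq_bigr => y _; rewrite cond_probP//.
      by apply: eq_integral => x _; rewrite cond_probE.
    move=> y; apply: (integrableS measurableT) => //.
    exact: integrable_density.
by apply: filterS => x h; have := h I; rewrite sumEFin => -[].
Qed.

End cond_prob.

(** * The joint law under unconfoundedness *)

Section ignorable.
Context (R : realType) (k m : nat) (d : measure_display) (X : measurableType d).
Implicit Types (y : potential k m) (A : set X).
Variable P : probability (decision k * potential k m * X)%type R.

Lemma potential_law_sum y A : measurable A ->
  potential_law P ([set y] `*` A) =
  (\sum_a P ([set a] `*` [set y] `*` A))%E.
Proof.
move=> mA; rewrite -(measure_fin_partition P xpredT).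
- congr (P _); apply/seteqP.
  split => [[[a z] x] [/= -> Ax]|[[a z] x] [b _ [[/= _ ->]]]]//.
  by exists a.
- by move=> a; apply: measurableX => //; apply: measurableX.
- apply/trivIsetP => a b _ _ ab; apply/seteqP; split => // -[[c z] x].
  by move=> [[[/= -> _] _] [[/eqP]]]; rewrite (negbTE ab).
Qed.

Lemma observed_law_sum j v A : measurable A ->
  observed_law P ([set j] `*` [set v] `*` A) =
  (\sum_(y : potential k m | y j == v) P ([set j] `*` [set y] `*` A))%E.
Proof.
move=> mA.
rewrite -(measure_fin_partition P (fun y : potential k m => y j == v)).
- congr (P _); apply/seteqP; split => [[[a y] x] [[/= -> <-] Ax]|].
    by exists y; [exact: eqxx | split].
  by move=> [[a y] x] [z /= /eqP <- [[/= -> ->] Ax]].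
- by move=> a; apply: measurableX => //; apply: measurableX.
- apply/trivIsetP => a b _ _ ab; apply/seteqP; split => // -[[c z] x].
  by move=> [[[/= _ ->] _] [[_ /eqP]]]; rewrite (negbTE ab).
Qed.

Variables (P0 : probability (potential k m * X)%type R)
  (e : R.-pker (potential k m * X)%type ~> decision k).
Hypothesis eP : is_joint_law e P0 P.

Lemma measurable_kprob_section a y :
  measurable_fun [set: X] (fun x => kprob e a (y, x)).
Proof.
apply: (measurableT_comp (measurable_kprob e a)); exact: measurable_pair1.
Qed.

(** Integrating against the measure [slice P0 y] instead of against a density
    makes the integrand nonnegative and bounded, and lets statements that hold
    [P0]-almost surely be used on each slice. *)
Lemma joint_law_slice a y A : measurable A ->
  P ([set a] `*` [set y] `*` A) =
  (\int[slice P0 y]_(x in A) (kprob e a (y, x))%:E)%E.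
Proof.
move=> mA; rewrite integral_slice//.
- rewrite eP//; apply: eq_integral => x _.
  by rewrite EFinM kprobE cond_probE.
- exact: measurable_kprob_section.
- exact: kprob_bounded.
Qed.

(** The assignment probabilities sum to one, so forgetting the decision gives
    back the law from which the joint law was built. *)
Lemma slice_potential_law y A : measurable A ->
  slice (potential_law P) y A = slice P0 y A.
Proof.
move=> mA; rewrite /slice potential_law_sum//.
under eq_bigr do rewrite joint_law_slice//.
rewrite -ge0_integral_sum//.
- under eq_integral do rewrite sumEFin kprob_sum1.
  by rewrite integral_cst// mul1e.
- move=> a; apply: measurable_funTS; apply/measurable_EFinP.
  exact: measurable_kprob_section.
- by move=> a x _; rewrite lee_fin kprob_ge0.
Qed.

Lemma ae_slice y (Q : potential k m * X -> Prop) :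
  {ae P0, forall z, Q z} -> {ae slice P0 y, forall x, Q (y, x)}.
Proof.
move=> [N [mN N0 QN]]; exists (xsection N y); split.
- exact: measurable_xsection.
- apply: (@subset_measure0 _ _ _ P0 _ N) => //.
    by apply: measurableX => //; exact: measurable_xsection.
  by move=> [z x] [/= -> /xsectionP].
- by move=> x /= nQ; apply/xsectionP/QN.
Qed.

Variable e0 : R.-pker X ~> decision k.
Hypothesis e0P : forall a, {ae P0, forall z, e z [set a] = e0 z.2 [set a]}.

(** Here the law of the potential outcomes is the one derived from [P], as in
    the definition of the risk, rather than the law [P0] that witnesses
    membership in the model. *)
Lemma ignorable_joint_law a y A : measurable A ->
  P ([set a] `*` [set y] `*` A) =
  (\int[covariate_law (potential_law P)]_(x in A)
    (kprob e0 a x * density (potential_law P) y x)%:E)%E.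
Proof.
move=> mA; rewrite -integral_slice//.
- rewrite joint_law_slice//.
  transitivity (\int[slice P0 y]_(x in A) (kprob e0 a x)%:E)%E.
    apply: ae_eq_integral => //.
    + apply: measurable_funTS; apply/measurable_EFinP.
      exact: measurable_kprob_section.
    + apply: measurable_funTS; apply/measurable_EFinP.
      exact: measurable_kprob.
    + have := ae_slice y (e0P a).
      by apply: filterS => x /= + _; rewrite !kprobE.
  apply: eq_measure_integral => B mB _.
  exact/esym/slice_potential_law.
- exact: measurable_kprob.
- exact: kprob_bounded.
Qed.

End ignorable.

(** * Identification of the marginal conditional laws *)

Lemma ae_measure_agree d (T : measurableType d) (R : realType)
    (mu nu : {measure set T -> \bar R}) (Q : T -> Prop) :
  (forall A, measurable A -> mu A = nu A) ->
  {ae mu, forall x, Q x} -> {ae nu, forall x, Q x}.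
Proof. by move=> mn [N [mN N0 QN]]; exists N; split; rewrite -?mn. Qed.

Section marginal.
Context (R : realType) (k m : nat) (d : measure_display) (X : measurableType d).
Implicit Types (A : set X).

Definition marginal (P : probability (potential k m * X)%type R) j v x : R :=
  \sum_(y : potential k m | y j == v) density P y x.

Lemma integrable_kprob_marginal P (e0 : R.-pker X ~> decision k) j v :
  (covariate_law P).-integrable [set: X]
    (EFin \o (fun x => kprob e0 j x * marginal P j v x)).
Proof.
rewrite (_ : _ \o _ = (fun x => \sum_(y : potential k m | y j == v)
    (kprob e0 j x)%:E * (density P y x)%:E)%E).
  apply: integrable_sum => // y _; apply: integrableMr => //.
  - exact: measurable_kprob.
  - exact: kprob_bounded.
  - exact: integrable_density.
apply/funext => x /=; rewrite mulr_sumr -sumEFin.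
by apply: eq_bigr => y _; rewrite EFinM.
Qed.

Lemma measurable_marginal P j v : measurable_fun [set: X] (marginal P j v).
Proof.
rewrite /marginal; under eq_fun do rewrite big_mkcond.
apply: measurable_sum => y; case: (y j == v) => //.
exact: measurable_density.
Qed.

Lemma model_observed_law P : model P ->
  exists e0 : R.-pker X ~> decision k,
    (forall a, {ae covariate_law (potential_law P), forall x, 0 < kprob e0 a x})
    /\ forall j v A, measurable A ->
      observed_law P ([set j] `*` [set v] `*` A) =
      (\int[covariate_law (potential_law P)]_(x in A)
        (kprob e0 j x * marginal (potential_law P) j v x)%:E)%E.
Proof.
move=> [e [P0 [[e0 [e0P e0_gt0]] eP]]]; exists e0; split.
  move=> a; apply: (@ae_measure_agree _ _ _ (covariate_law P0)).
    move=> A mA; rewrite [LHS]covariate_law_sum// [RHS]covariate_law_sum//.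
    by apply: eq_bigr => y _; exact/esym/(slice_potential_law eP).
  by apply: filterS (e0_gt0 a) => x; rewrite kprobE lte_fin.
move=> j v A mA; rewrite observed_law_sum//.
under eq_bigr do rewrite (ignorable_joint_law eP e0P)//.
rewrite -integral_sum//.
  by apply: eq_integral => x _; rewrite /marginal mulr_sumr sumEFin.
move=> y; apply: (integrableS measurableT) => //.
rewrite (_ : (fun x => _) =
    (EFin \o kprob e0 j) \* (EFin \o density (potential_law P) y))%E.
  apply: integrableMr => //.
  - exact: measurable_kprob.
  - exact: kprob_bounded.
  - exact: integrable_density.
by apply/funext => x /=; rewrite EFinM.
Qed.

Lemma ae_marginal_sum1 (P : probability (potential k m * X)%type R) j :
  {ae covariate_law P, forall x, \sum_v marginal P j v x = 1}.
Proof.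
apply: filterS (ae_density_sum1 P) => x <-.
by rewrite /marginal [RHS](partition_big (fun y : potential k m => y j) xpredT).
Qed.

(** Summing over the outcomes removes the unknown marginal laws, which leaves
    an equation for the propensity score alone. *)
Lemma observed_law_decision P (e0 : R.-pker X ~> decision k) j A :
  (forall v A, measurable A ->
      observed_law P ([set j] `*` [set v] `*` A) =
      (\int[covariate_law (potential_law P)]_(x in A)
        (kprob e0 j x * marginal (potential_law P) j v x)%:E)%E) ->
  measurable A ->
  (\int[covariate_law (potential_law P)]_(x in A) (kprob e0 j x)%:E =
    \sum_v observed_law P ([set j] `*` [set v] `*` A))%E.
Proof.
move=> QE mA; under eq_bigr do rewrite QE//.
rewrite -integral_sum//; last first.
  move=> v; apply: (integrableS measurableT) => //.
  exact: integrable_kprob_marginal.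
apply: ae_eq_integral => //.
- by apply: measurable_funTS; apply/measurable_EFinP; exact: measurable_kprob.
- apply: emeasurable_sum => v; apply: measurable_funTS; apply/measurable_EFinP.
  apply: measurable_funM; first exact: measurable_kprob.
  exact: measurable_marginal.
- apply: filterS (ae_marginal_sum1 (potential_law P) j) => x m1 _.
  by rewrite sumEFin -mulr_sumr m1 mulr1.
Qed.

Variables P1 P2 : probability (decision k * potential k m * X)%type R.
Hypotheses (mP1 : model P1) (mP2 : model P2).
Hypothesis P12 :
  forall B, measurable B -> observed_law P1 B = observed_law P2 B.

Lemma covariate_law_identified A : measurable A ->
  covariate_law (potential_law P1) A = covariate_law (potential_law P2) A.
Proof.
move=> mA.
have covE (P : probability (decision k * potential k m * X)%type R) :
    covariate_law (potential_law P) A = observed_law P ([set: _] `*` A).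
  by congr (P _); apply/seteqP; split => [z Az|z []//]; split.
by rewrite [LHS]covE [RHS]covE P12//; exact: measurableX.
Qed.

(** Densities with equal integrals over all measurable sets agree almost
    everywhere. This is applied twice: to the propensity scores, and to their
    products with the marginals. Overlap then cancels the propensity score. *)
Lemma marginal_identified j v : {ae covariate_law (potential_law P1), forall x,
  marginal (potential_law P1) j v x = marginal (potential_law P2) j v x}.
Proof.
have [e1 [e1_gt0 Q1]] := model_observed_law mP1.
have [e2 [_ Q2]] := model_observed_law mP2.
set mu1 := covariate_law (potential_law P1).
set mu2 := covariate_law (potential_law P2).
have mu12 A (f : X -> \bar R) : measurable A ->
    (\int[mu2]_(x in A) f x = \int[mu1]_(x in A) f x)%E.
  move=> mA; apply: eq_measure_integral => B mB _.
  exact/esym/covariate_law_identified.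
have e12 : ae_eq mu1 [set: X] (EFin \o kprob e1 j) (EFin \o kprob e2 j).
  apply: integral_ae_eq => //.
  - apply: measurable_bounded_integrable => //.
    + by rewrite ltey_eq fin_num_measure.
    + exact: measurable_kprob.
    + exact: kprob_bounded.
  - by apply/measurable_EFinP; exact: measurable_kprob.
  - move=> A _ mA; rewrite (observed_law_decision (Q1 j))// -mu12//.
    rewrite (observed_law_decision (Q2 j))//; apply: eq_bigr => w _.
    by rewrite P12//; apply: measurableX => //; apply: measurableX.
have m12 : ae_eq mu1 [set: X]
    (EFin \o (fun x => kprob e1 j x * marginal (potential_law P1) j v x))
    (EFin \o (fun x => kprob e2 j x * marginal (potential_law P2) j v x)).
  apply: integral_ae_eq => //.
  - exact: integrable_kprob_marginal.
  - apply/measurable_EFinP; apply: measurable_funM.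
      exact: measurable_kprob.
    exact: measurable_marginal.
  - move=> A _ mA; rewrite -Q1// -mu12// -Q2//.
    by rewrite P12//; apply: measurableX => //; apply: measurableX.
apply: filterS3 (e1_gt0 j) e12 m12 => x e1x /(_ I)[e12x] /(_ I)[].
by rewrite -e12x => /mulfI; apply; rewrite gt_eqF.
Qed.

End marginal.

(** * Risk differences of additive losses *)

Lemma bounded_fun_exP (T : Type) (R : realType) (f : T -> R) :
  bounded_fun f <-> exists M, forall x, `|f x| <= M.
Proof.
split=> [[M [_ Mf]]|[M Mf]].
  by exists (M + 1) => x; apply: Mf => //; rewrite ltrDl.
exists M; split; first exact: num_real.
by move=> N MN x _; exact: (le_trans (Mf x) (ltW MN)).
Qed.

Section risk.
Context (R : realType) (k m : nat) (d : measure_display) (X : measurableType d).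
Variable l : {mfun (decision k * potential k m * X)%type >-> R}.
Implicit Types (P : probability (decision k * potential k m * X)%type R)
  (pi rho : R.-pker X ~> decision k).

Lemma measurable_loss_kprob pi a y :
  measurable_fun [set: X] (fun x => l (a, y, x) * kprob pi a x).
Proof.
apply: measurable_funM; last exact: measurable_kprob.
by apply: (measurableT_comp (measurable_funPT l)); exact: measurable_pair1.
Qed.

Lemma measurable_cond_risk P pi : measurable_fun [set: X] (cond_risk P pi l).
Proof.
apply: measurable_sum => a; apply: measurable_sum => y.
apply: measurable_funM; first exact: measurable_loss_kprob.
exact: measurable_density.
Qed.

Lemma integrable_cond_risk P pi : bounded_fun l ->
  (covariate_law (potential_law P)).-integrable [set: X]
    (EFin \o cond_risk P pi l).
Proof.
move=> /bounded_fun_exP[M lM].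
rewrite (_ : _ \o _ = (fun x => \sum_(a : decision k) \sum_(y : potential k m)
    (l (a, y, x) * kprob pi a x)%:E * (density (potential_law P) y x)%:E)%E).
  apply: integrable_sum => // a _; apply: integrable_sum => // y _.
  apply: integrableMr => //.
  - exact: measurable_loss_kprob.
  - apply/bounded_fun_exP; exists M => x; rewrite normrM -[M]mulr1.
    by apply: ler_pM => //; rewrite ger0_norm ?kprob_ge0 ?kprob_le1.
  - exact: integrable_density.
apply/funext => x /=; rewrite /cond_risk -sumEFin; apply: eq_bigr => a _.
by rewrite -sumEFin; apply: eq_bigr => y _; rewrite EFinM.
Qed.

Lemma risk_difference P pi rho : bounded_fun l ->
  risk P pi l - risk P rho l =
  (\int[covariate_law (potential_law P)]_x
    (cond_risk P pi l x - cond_risk P rho l x))%R.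
Proof. by move=> bl; rewrite RintegralB//; exact: integrable_cond_risk. Qed.

(** The term [varpi] is multiplied by the total mass of the difference of the
    two policies, which is zero; in the term [omega j], grouping the outcome
    vectors by their [j]-th coordinate makes the marginals appear. *)
Lemma additive_cond_risk_difference P pi rho x
    (omega : decision k -> decision k * outcome m * X -> R)
    (varpi : potential k m * X -> R) :
  (forall a y x, l (a, y, x) =
    varpi (y, x) + \sum_(j : decision k) omega j (a, y j, x)) ->
  cond_risk P pi l x - cond_risk P rho l x =
  \sum_(a : decision k) (kprob pi a x - kprob rho a x) *
    \sum_(j : decision k) \sum_(v : outcome m)
      omega j (a, v, x) * marginal (potential_law P) j v x.
Proof.
move=> lE; pose p y := density (potential_law P) y x.
pose D a := kprob pi a x - kprob rho a x.
have D0 : \sum_a D a = 0 by rewrite sumrB !kprob_sum1 subrr.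
transitivity (\sum_(a : decision k) \sum_(y : potential k m)
    D a * l (a, y, x) * p y).
  rewrite /cond_risk -sumrB; apply: eq_bigr => a _.
  rewrite -sumrB; apply: eq_bigr => y _.
  rewrite -/(kprob pi a x) -/(kprob rho a x) -/(density _ _ _) -/(p y).
  by rewrite -mulrBl -mulrBr [D a * _]mulrC.
transitivity (\sum_(a : decision k) \sum_(y : potential k m)
    D a * (\sum_j omega j (a, y j, x)) * p y).
  (* the two sides differ by the contribution of varpi *)
  apply/eqP; rewrite -subr_eq0 -sumrB; apply/eqP.
  transitivity (\sum_(a : decision k) D a * \sum_y varpi (y, x) * p y).
    apply: eq_bigr => a _; rewrite -sumrB mulr_sumr; apply: eq_bigr => y _.
    by rewrite lE -mulrBl -mulrBr addrK mulrA.
  by rewrite -mulr_suml D0 mul0r.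
apply: eq_bigr => a _; rewrite mulr_sumr.
under eq_bigr do rewrite mulr_sumr mulr_suml.
rewrite exchange_big /=; apply: eq_bigr => j _.
rewrite (partition_big (fun y : potential k m => y j) xpredT)//= mulr_sumr.
apply: eq_bigr => v _; rewrite /marginal !mulr_sumr.
by apply: eq_bigr => y /eqP <-; rewrite mulrA.
Qed.

Lemma additive_identifiable pi rho : bounded_fun l -> additive_loss l ->
  identifiable (fun P => risk P pi l - risk P rho l).
Proof.
move=> bl [omega [varpi [_ _ lE]]] P1 P2 mP1 mP2 P12.
have diffE := additive_cond_risk_difference (omega := fun j => omega j) _ _ _ _
  lE.
rewrite !risk_difference//.
rewrite [in RHS]/Rintegral
  (@eq_measure_integral _ _ _ _ (covariate_law (potential_law P1))); last first.
  by move=> A mA _; exact/esym/covariate_law_identified.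
congr fine; apply: ae_eq_integral => //.
- apply/measurable_EFinP.
  by apply: measurable_funB; exact: measurable_cond_risk.
- apply/measurable_EFinP.
  by apply: measurable_funB; exact: measurable_cond_risk.
- have : {ae covariate_law (potential_law P1), forall x, forall j v,
      marginal (potential_law P1) j v x = marginal (potential_law P2) j v x}.
    apply: filter_forall => j; apply: filter_forall => v.
    exact: marginal_identified.
  apply: filterS => x m12 _; congr EFin.
  rewrite [LHS]diffE [RHS]diffE.
  apply: eq_bigr => a _; congr (_ * _); apply: eq_bigr => j _.
  by apply: eq_bigr => v _; rewrite m12.
Qed.

End risk.

(** * Finite mixtures over one covariate value *)

Section empirical.
Context d (T : measurableType d) (R : realType) (I : finType) (i0 : I).
Variable z : I -> T.

(** The uniform law on the values of [z], counted with multiplicity. The index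
    [i0] witnesses that [I] is inhabited; as a default of [nth] it is never
    reached. *)
Definition empirical : set T -> \bar R :=
  mscale (#|I|%:R^-1)%:nng
    (msum (fun k => \d_(z (nth i0 (enum I) k))) #|I|).

HB.instance Definition _ := Measure.on empirical.

Lemma empiricalE A : empirical A = (#|I|%:R^-1 * \sum_i (z i \in A)%:R)%:E.
Proof.
rewrite /empirical/= /mscale/= /msum EFinM -sumEFin; congr (_ * _)%E.
rewrite -[RHS]big_enum /= (big_nth i0) big_mkord -cardE.
by apply: eq_bigr => k _; rewrite diracE.
Qed.

Let empirical_setT : empirical [set: T] = 1%E.
Proof.
rewrite empiricalE; under eq_bigr do rewrite in_setT.
rewrite sumr_const mulVf// pnatr_eq0 -lt0n.
by apply/card_gt0P; exists i0.
Qed.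

HB.instance Definition _ :=
  Measure_isProbability.Build _ _ _ empirical empirical_setT.

End empirical.

Section mixture.
Context (R : realType) (k m : nat) (d : measure_display) (X : measurableType d).
Variables (w : decision k -> potential k m) (x : X).

Definition uniform : probability (decision k) R := empirical R ord0 id.

(** The joint law of independent uniform [D] and [i], with [Y(D) = w i] and
    [X = x]. *)
Definition mixture : probability (decision k * potential k m * X)%type R :=
  empirical R (ord0, ord0) (fun p : decision k * decision k => (p.1, w p.2, x)).

Local Notation K := (k.+2%:R : R).

Let K_neq0 : K != 0. Proof. by rewrite pnatr_eq0. Qed.

Lemma mixtureE A :
  mixture A = (K^-1 * \sum_a (K^-1 * \sum_i ((a, w i, x) \in A)%:R))%:E.
Proof.
rewrite [LHS]empiricalE card_prod card_ord natrM invfM -mulr_sumr mulrA.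
by rewrite (pair_bigA _ (fun a i => ((a, w i, x) \in A)%:R)).
Qed.

Lemma potential_law_mixtureE A :
  potential_law mixture A = (K^-1 * \sum_i ((w i, x) \in A)%:R)%:E.
Proof.
rewrite -[LHS]/(mixture (unassigned @^-1` A)) mixtureE; congr EFin.
rewrite -[RHS](mulKf K_neq0); congr (_ * _).
rewrite [LHS](eq_bigr (fun=> K^-1 * \sum_i ((w i, x) \in A)%:R)).
  by rewrite sumr_const card_ord mulr_natl.
by move=> a _; congr (_ * _); apply: eq_bigr.
Qed.

Lemma covariate_law_mixtureE A :
  covariate_law (potential_law mixture) A = \d_x A.
Proof.
rewrite -[LHS]/(potential_law mixture (covariate @^-1` A)).
rewrite potential_law_mixtureE diracE; congr EFin.
rewrite (eq_bigr (fun=> (x \in A)%:R))//.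
by rewrite sumr_const card_ord -[X in _^-1 * X]mulr_natl mulKf.
Qed.

Lemma integral_mixture A (f : X -> \bar R) : measurable A ->
  measurable_fun [set: X] f ->
  (\int[covariate_law (potential_law mixture)]_(y in A) f y = \d_x A * f x)%E.
Proof.
move=> mA mf; rewrite -integral_dirac//; last exact: measurable_funTS.
by apply: eq_measure_integral => B mB _; exact: covariate_law_mixtureE.
Qed.

(** A density is in general determined only almost everywhere; since all the
    mass of the covariate sits at [x], its value at [x] is determined. *)
Lemma density_mixture y :
  density (potential_law mixture) y x = K^-1 * \sum_i (w i == y)%:R.
Proof.
apply: EFin_inj; rewrite -cond_probE.
have := cond_probP (potential_law mixture) y measurableT.
rewrite integral_mixture//; last exact: measurable_cond_prob.
rewrite diracT mul1e potential_law_mixtureE => <-; congr EFin; congr (_ * _).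
apply: eq_bigr => i _; congr (nat_of_bool _)%:R; apply/idP/eqP.
  by rewrite inE => -[].
by move=> ->; rewrite inE.
Qed.

Definition uniform_kernel d' (Y : measurableType d') :
    Y -> {measure set (decision k) -> \bar R} :=
  kprobability (measurable_cst (uniform : pprobability (decision k) R)).

HB.instance Definition _ d' (Y : measurableType d') :=
  ProbabilityKernel.on (@uniform_kernel d' Y).

Lemma uniform_kernelE d' (Y : measurableType d') (y : Y) a :
  uniform_kernel y [set a] = K^-1%:E.
Proof.
rewrite -[LHS]/(uniform [set a]) [LHS]empiricalE card_ord (bigD1 a)//=.
rewrite mem_set// big1 ?addr0 ?mulr1// => b ba.
by rewrite memNset//= => /eqP; rewrite (negbTE ba).
Qed.

Lemma model_mixture : model mixture.
Proof.
exists (@uniform_kernel _ _), (potential_law mixture); split.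
  exists (@uniform_kernel _ _); split => a; apply: aeW => z.
    by rewrite !uniform_kernelE.
  by rewrite uniform_kernelE lte_fin invr_gt0.
move=> a y A mA.
under eq_integral do rewrite uniform_kernelE.
rewrite integral_mixture//; last first.
  apply: emeasurable_funM => //; exact: measurable_cond_prob.
rewrite mixtureE cond_probE density_mixture diracE -!EFinM; congr EFin.
rewrite mulrCA; congr (_ * _); rewrite (bigD1 a)//= [X in _ + X]big1 ?addr0.
  rewrite mulrCA; congr (_ * _); rewrite mulr_sumr; apply: eq_bigr => i _.
  rewrite -natrM mulnb; congr (nat_of_bool _)%:R.
  apply/idP/andP; rewrite !inE/=; first by move=> [[_ ->] ?]; rewrite eqxx.
  by move=> [? /eqP].
move=> b ba; rewrite big1 ?mulr0// => i _.
by rewrite memNset//= => -[[/eqP]]; rewrite (negbTE ba).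
Qed.

Lemma observed_law_mixtureE A :
  observed_law mixture A =
  (K^-1 * \sum_a (K^-1 * \sum_i ((a, w i a, x) \in A)%:R))%:E.
Proof.
by rewrite -[LHS]/(mixture (observed @^-1` A)) mixtureE.
Qed.

Lemma risk_mixture (l : {mfun (decision k * potential k m * X)%type >-> R})
    (pi : R.-pker X ~> decision k) :
  risk mixture pi l = K^-1 * \sum_i \sum_a l (a, w i, x) * kprob pi a x.
Proof.
rewrite /risk /Rintegral integral_mixture//; last first.
  by apply/measurable_EFinP; exact: measurable_cond_risk.
rewrite diracT mul1e /= /cond_risk.
transitivity (\sum_(a : decision k) \sum_(y : potential k m)
  l (a, y, x) * kprob pi a x * (K^-1 * \sum_i (w i == y)%:R)).
  by apply: eq_bigr => a _; apply: eq_bigr => y _; rewrite -density_mixture.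
rewrite [in RHS]exchange_big mulr_sumr; apply: eq_bigr => a _.
transitivity (K^-1 * \sum_(y : potential k m) \sum_i
  l (a, y, x) * kprob pi a x * (w i == y)%:R).
  by rewrite mulr_sumr; apply: eq_bigr => y _; rewrite mulrCA mulr_sumr.
congr (_ * _); rewrite exchange_big; apply: eq_bigr => i _ /=.
rewrite (bigD1 (w i))//= eqxx mulr1 big1 ?addr0// => y /negbTE.
by rewrite eq_sym => ->; rewrite mulr0.
Qed.

End mixture.

(** * Laws that the observations cannot separate *)

Section separating_pair.
Context (R : realType) (k m : nat) (d : measure_display) (X : measurableType d).
Implicit Types (y : potential k m) (x : X) (a : decision k).

Definition outcomes0 : potential k m := [ffun=> ord0].

Definition deviation (j : decision k) (v : outcome m) : potential k m :=
  [ffun i => if i == j then v else ord0].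

(** The first list moves all coordinates at once with weight 1 / K, the second
    one moves one coordinate at a time. Indexing both by the decisions, with
    [y] itself at index 0, lets one transposition match them in
    [sum_coordinate]. *)
Definition joint_deviation y (i : decision k) :=
  if i == ord0 then y else outcomes0.

Definition split_deviation y (i : decision k) := deviation i (y i).

(** In coordinate [a], the entry with index 0 of the first list and the entry
    with index [a] of the second list carry the outcome [y a], and all other
    entries carry 0. Swapping the two indices matches the lists. *)
Lemma sum_coordinate (F : outcome m -> R) y a :
  \sum_(i : decision k) F (joint_deviation y i a) =
  \sum_(i : decision k) F (split_deviation y i a).
Proof.
rewrite [RHS](reindex_inj (@perm_inj _ (tperm ord0 a))); apply: eq_bigr => i _.
congr F; rewrite /joint_deviation /split_deviation /outcomes0 ffunE.
case: tpermP => [->|->|/eqP/negbTE i0 /eqP/negbTE ia].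
- by rewrite !eqxx.
- by case: eqVneq => [->|_]; rewrite ?eqxx// ffunE.
- by rewrite i0 eq_sym ia ffunE.
Qed.

Lemma observed_law_joint_split y x A : measurable A ->
  observed_law (mixture R (joint_deviation y) x) A =
  observed_law (mixture R (split_deviation y) x) A.
Proof.
move=> mA; rewrite !observed_law_mixtureE; congr (_ * _)%:E.
apply: eq_bigr => a _.
by rewrite (sum_coordinate (fun v => ((a, v, x) \in A)%:R)).
Qed.

Definition pure_policy a : X -> {measure set (decision k) -> \bar R} :=
  kdirac (measurable_cst a).

HB.instance Definition _ a := ProbabilityKernel.on (pure_policy a).

Lemma kprob_pure_policy a b x : kprob (pure_policy a) b x = (a == b)%:R.
Proof.
rewrite /kprob -[pure_policy a x _]/(\d_a [set b]) diracE /=.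
by congr (nat_of_bool _)%:R; apply/idP/eqP; rewrite inE.
Qed.

Variable l : {mfun (decision k * potential k m * X)%type >-> R}.

Lemma risk_pure_policy w x a :
  risk (mixture R w x) (pure_policy a) l =
  k.+2%:R^-1 * \sum_(i : decision k) l (a, w i, x).
Proof.
rewrite risk_mixture; congr (_ * _); apply: eq_bigr => i _.
rewrite (bigD1 a)//= kprob_pure_policy eqxx mulr1 big1 ?addr0// => b.
by rewrite kprob_pure_policy eq_sym => /negbTE ->; rewrite mulr0.
Qed.

Definition contrast a y x : R := l (a, y, x) - l (ord0, y, x).

Lemma identifiable_contrast a y x :
  identifiable (fun P =>
    risk P (pure_policy a) l - risk P (pure_policy ord0) l) ->
  contrast a y x =
  \sum_(j : decision k) contrast a (deviation j (y j)) x -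
  k.+1%:R * contrast a outcomes0 x.
Proof.
move=> /(_ _ _ (model_mixture _ _ _) (model_mixture _ _ _)
  (@observed_law_joint_split y x)).
rewrite !risk_pure_policy -!mulrBr -!sumrB => /mulfI.
rewrite invr_eq0 pnatr_eq0 => /(_ isT).
rewrite (bigD1 ord0)//= /joint_deviation eqxx => E.
apply/eqP; rewrite eq_sym subr_eq eq_sym; apply/eqP; rewrite -[RHS]E.
congr (_ + _); rewrite (eq_bigr (fun=> contrast a outcomes0 x)); last first.
  by move=> i /negbTE ->.
by rewrite sumr_const cardC1 card_ord mulr_natl.
Qed.

(** The constant [(K - 1) g(0)] of [identifiable_contrast] is spread evenly over
    the K terms, hence the factor (K - 1) / K. *)
Definition interaction j (z : decision k * outcome m * X) : R :=
  contrast z.1.1 (deviation j z.1.2) z.2 -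
  k.+1%:R / k.+2%:R * contrast z.1.1 outcomes0 z.2.

Definition base_loss (z : potential k m * X) : R := l (ord0, z.1, z.2).

Lemma measurable_loss_section a y :
  measurable_fun [set: X] (fun x => l (a, y, x)).
Proof.
apply: (measurableT_comp (measurable_funPT l)); exact: measurable_pair1.
Qed.

Lemma measurable_contrast a y : measurable_fun [set: X] (contrast a y).
Proof. by apply: measurable_funB; exact: measurable_loss_section. Qed.

Lemma measurable_interaction j : measurable_fun [set: _] (interaction j).
Proof.
apply: measurable_fun_finite_factor.
- exact: finite_finset.
- move=> [a v]; rewrite -(_ : [set a] `*` [set v] = [set (a, v)]).
    exact: measurableX.
  by apply/seteqP; split => [[b u] [/= -> ->]|_ ->].
- move=> [a v]; apply: measurable_funB.
    exact: (measurable_contrast a (deviation j v)).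
  by apply: measurable_funM; [exact: measurable_cst|exact: measurable_contrast].
Qed.

HB.instance Definition _ j :=
  isMeasurableFun.Build _ _ _ _ (interaction j) (measurable_interaction j).

Lemma measurable_base_loss : measurable_fun [set: _] base_loss.
Proof.
apply: measurable_fun_finite_factor => //.
- exact: finite_finset.
- by move=> y; exact: measurable_loss_section.
Qed.

HB.instance Definition _ :=
  isMeasurableFun.Build _ _ _ _ base_loss measurable_base_loss.

Lemma identifiable_additive : bounded_fun l ->
  (forall pi rho : R.-pker X ~> decision k,
    identifiable (fun P => risk P pi l - risk P rho l)) ->
  additive_loss l.
Proof.
move=> /bounded_fun_exP[M lM] idl; exists interaction, base_loss; split.
- move=> j; apply/bounded_fun_exP.
  have cM a y x : `|contrast a y x| <= M + M.
    by rewrite (le_trans (ler_normB _ _))// lerD.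
  exists (M + M + k.+1%:R / k.+2%:R * (M + M)) => z.
  rewrite (le_trans (ler_normB _ _))// lerD// normrM ger0_norm ?divr_ge0//.
  by rewrite ler_wpM2l// divr_ge0.
- by apply/bounded_fun_exP; exists M => z; exact: lM.
- move=> a y x; apply/eqP; rewrite addrC -subr_eq; apply/eqP.
  rewrite -[LHS]/(contrast a y x) (identifiable_contrast _ _ (idl _ _)).
  rewrite [RHS](eq_bigr (fun j => contrast a (deviation j (y j)) x -
    k.+1%:R / k.+2%:R * contrast a outcomes0 x))//.
  rewrite [RHS]sumrB sumr_const card_ord; congr (_ - _).
  by rewrite -[RHS]mulr_natl mulrA [k.+2%:R * _]mulrC divfK// pnatr_eq0.
Qed.

End separating_pair.

Theorem theorem2 (R : realType) (k m : nat) (d : measure_display)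
  (X : measurableType d)
  (l : {mfun (decision k * potential k m * X)%type >-> R})
  (hl : bounded_fun l) :
  (forall pi rho : R.-pker X ~> decision k,
     identifiable (fun P => risk P pi l - risk P rho l))
  <-> additive_loss l.
Proof.
split=> [|al pi rho]; first exact: identifiable_additive.
exact: additive_identifiable.
Qed.
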